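(* Let $p<n$, and let the singular values of $Q_A$ be labeled $1=c_1>c_2>\cdots>c_{p+1}>0$, where $c_1=1$ has multiplicity $n-p$ and $c_2,\dots,c_{p+1}$ are simple, with $P_A$, $W$, $G$ partitioned correspondingly as in the context, and let $g_\perp=G_1P_{1,A}^Tb\in\mathcal N(L)$. Let $x_k$ be the $k$-th iterate of the joint bidiagonalization based algorithm described in the context, and let $\widetilde c_1,\dots,\widetilde c_k$ be the singular values of $B_k$. Then, for $k=1,2,\dots,p+1$ (as long as the process does not break down), $$x_k=f_1^{(k)}g_\perp+\sum_{i=2}^{p+1}f_i^{(k)}\frac{p_{i,A}^Tb}{c_i}\,g_i,$$ where the filters are $$f_i^{(k)}=1-\prod_{j=1}^k\frac{\widetilde c_j^{\,2}-c_i^2}{\widetilde c_j^{\,2}},\qquad i=1,2,\dots,p+1.$$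
   Context: $\|\cdot\|$ is the Euclidean norm. $A\in\mathbb{R}^{m\times n}$, $L\in\mathbb{R}^{p\times n}$ of rank $\min\{n,p\}$, $m\ge n$, $\mathcal N(A)\cap\mathcal N(L)=\{\mathbf 0\}$, and $b\in\mathbb{R}^m$ is nonzero. Let $\begin{pmatrix}A\\L\end{pmatrix}=QR$ be the compact QR factorization, $Q=\begin{pmatrix}Q_A\\Q_L\end{pmatrix}$ with orthonormal columns, $Q_A\in\mathbb{R}^{m\times n}$, $Q_L\in\mathbb{R}^{p\times n}$, and $R\in\mathbb{R}^{n\times n}$ nonsingular upper triangular. Let $Q_A=P_ACW^T$, $Q_L=P_LSW^T$ be the CS decomposition, with $P_A\in\mathbb{R}^{m\times m}$, $P_L\in\mathbb{R}^{p\times p}$, $W\in\mathbb{R}^{n\times n}$ orthogonal and $C$, $S$ diagonal with $C^TC+S^TS=I_n$; put $G=R^{-1}W$, so $A=P_ACG^{-1}$, $L=P_LSG^{-1}$ (the GSVD of $\{A,L\}$; the columns of $G$ are the generalized right singular vectors). For $p<n$, the diagonal entries of $C$ consist of the value $1$ repeated $n-p$ times and $p$ further values assumed to lie in $(0,1)$. They are ordered so that the $n-p$ entries equal to $1$ come first, this common value being called $c_1$, followed by $c_2\ge c_3\ge\cdots\ge c_{p+1}$. Correspondingly the columns are written $$P_A=(P_{1,A},p_{2,A},\dots,p_{m-n+p+1,A}),\quad W=(W_1,w_2,\dots,w_{p+1}),\quad G=(G_1,g_2,\dots,g_{p+1}),$$ where $P_{1,A},W_1,G_1$ consist of the $n-p$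 columns belonging to $c_1=1$ and $p_{i,A},w_i,g_i$ belong to $c_i$; thus $G_1=R^{-1}W_1$, $g_i=R^{-1}w_i$, and $\mathcal R(G_1)=\mathcal N(L)$. Algorithm: set $\beta_1u_1=b$ with $\beta_1=\|b\|$, $\alpha_1v_1=Q_A^Tu_1$, and for $i=1,2,\dots,k$ $$\beta_{i+1}u_{i+1}=Q_Av_i-\alpha_iu_i,\qquad \alpha_{i+1}v_{i+1}=Q_A^Tu_{i+1}-\beta_{i+1}v_i,$$ where $\alpha_i,\beta_i\ge0$ are chosen so that $u_i,v_i$ have unit norm; no breakdown up to step $k$ means $\alpha_1,\dots,\alpha_k$ and $\beta_1,\dots,\beta_k$ are nonzero. (This is the part of the joint bidiagonalization of $\{A,L\}$ that concerns $A$.) Let $V_k=(v_1,\dots,v_k)$, $Z_k=R^{-1}V_k$, and let $B_k\in\mathbb{R}^{(k+1)\times k}$ be lower bidiagonal with diagonal entries $\alpha_1,\dots,\alpha_k$ and subdiagonal entries $\beta_2,\dots,\beta_{k+1}$. With $e_1$ the first canonical vector of $\mathbb{R}^{k+1}$, set $y_k=\arg\min_{y\in\mathbb{R}^k}\|B_ky-\beta_1e_1\|$ and $x_k=Z_ky_k$. *)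

(* Defs.v *)
From HB Require Import structures.
From mathcomp Require Import all_boot all_order all_algebra.
From mathcomp Require Import reals.

Set Implicit Arguments.
Unset Strict Implicit.
Unset Printing Implicit Defensive.

Import Order.TTheory GRing.Theory Num.Theory.
Local Open Scope ring_scope.

Definition enorm (R : realType) (n : nat) (x : 'cV[R]_n) : R :=
  Num.sqrt (\sum_(i < n) x i ord0 ^+ 2).

(* For a square matrix this says that the matrix is orthogonal. *)
Definition orthonormal_cols (R : realType) (m n : nat) (P : 'M[R]_(m, n)) :
  Prop := P^T *m P = 1%:M.

Definition singular_values (R : realType) (m n : nat) (M : 'M[R]_(m, n))
    (s : 'I_n -> R) : Prop :=
  [/\ (n <= m)%N, forall j, 0 <= s j &
      exists (U : 'M[R]_m) (V : 'M[R]_n),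
        [/\ orthonormal_cols U, orthonormal_cols V &
            M = U *m (\matrix_(i < m, j < n) (s j *+ (i == j :> nat))) *m V^T]].

(* [is_trig_mx] is lower triangularity, hence the transpose. *)
Definition compact_QR (R : realType) (m n : nat) (M Q : 'M[R]_(m, n))
    (T : 'M[R]_n) : Prop :=
  [/\ M = Q *m T, orthonormal_cols Q, is_trig_mx T^T & T \in unitmx].

(* The columns are ordered so that the zero columns of S come first when     *)
(* p < n: S = (0, diag(s_2, ..., s_(p+1))), so its diagonal is shifted by    *)
(* n - p.  For p >= n, the truncated n - p is 0: S has the usual diagonal.   *)
Definition CS_decomposition (R : realType) (m n p : nat)
    (QA : 'M[R]_(m, n)) (QL : 'M[R]_(p, n)) (PA : 'M[R]_m) (PL : 'M[R]_p)
    (W : 'M[R]_n) (C : 'M[R]_(m, n)) (S : 'M[R]_(p, n)) : Prop :=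
  [/\ [/\ orthonormal_cols PA, orthonormal_cols PL & orthonormal_cols W],
      QA = PA *m C *m W^T /\ QL = PL *m S *m W^T,
      is_diag_mx C,
      (forall (i : 'I_p) (j : 'I_n), j != (n - p + i)%N :> nat -> S i j = 0) &
      C^T *m C + S^T *m S = 1%:M].

(* Positions of the first n - p and of the last p columns.  Position         *)
(* [last_ord hpn i], for i = 0, ..., p - 1, is that of the value c_(i+2).    *)
Definition first_ord (n p : nat) (i : 'I_(n - p)) : 'I_n :=
  widen_ord (leq_subr p n) i.

Definition last_ord (n p : nat) (hpn : (p < n)%N) (i : 'I_p) : 'I_n :=
  cast_ord (subnK (ltnW hpn)) (rshift (n - p) i).

(* Sequences are indexed from 1; their values at 0 are irrelevant.  When a   *)
(* coefficient vanishes, the vector that it multiplies cannot be normalized  *)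
(* and is left arbitrary.                                                    *)
Definition bidiagonalization (R : realType) (m n : nat) (QA : 'M[R]_(m, n))
    (b : 'cV[R]_m) (k : nat) (alpha beta : nat -> R)
    (u : nat -> 'cV[R]_m) (v : nat -> 'cV[R]_n) : Prop :=
  [/\ beta 1%N = enorm b,
      beta 1%N *: u 1%N = b,
      alpha 1%N *: v 1%N = QA^T *m u 1%N,
      (forall i, (1 <= i <= k)%N ->
        beta i.+1 *: u i.+1 = QA *m v i - alpha i *: u i /\
        alpha i.+1 *: v i.+1 = QA^T *m u i.+1 - beta i.+1 *: v i) &
      (forall i, (1 <= i <= k.+1)%N ->
        [/\ 0 <= alpha i, 0 <= beta i,
            alpha i != 0 -> enorm (v i) = 1 &
            beta i != 0 -> enorm (u i) = 1])].

Definition no_breakdown (R : realType) (k : nat) (alpha beta : nat -> R) :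
  Prop := forall i, (1 <= i <= k)%N -> alpha i != 0 /\ beta i != 0.

Definition V_mx (R : realType) (n k : nat) (v : nat -> 'cV[R]_n) :
  'M[R]_(n, k) := \matrix_(i < n, j < k) v j.+1 i ord0.

Definition B_mx (R : realType) (k : nat) (alpha beta : nat -> R) :
    'M[R]_(k.+1, k) :=
  \matrix_(i < k.+1, j < k)
    if i == j :> nat then alpha j.+1
    else if i == j.+1 :> nat then beta j.+2
    else 0.

Definition is_argmin (T : Type) (R : realType) (F : T -> R) (y : T) : Prop :=
  forall z, F y <= F z.

(* Main.v *)
Require Import Defs.
From HB Require Import structures.
From mathcomp Require Import all_boot all_order all_algebra.
From mathcomp Require Import ring reals.

Set Implicit Arguments.
Unset Strict Implicit.
Unset Printing Implicit Defensive.

Import Order.TTheory GRing.Theory Num.Theory.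
Local Open Scope ring_scope.

(** Write M for the upper block of Q, H for B_k^T B_k, and V for the matrix of
    the vectors v_1, ..., v_k. The normal equations of the projected least
    squares problem are H y = alpha_1 beta_1 e_1, and with
    chi(t) = prod_j (1 - t / ct_j^2), a multiple of the characteristic
    polynomial of H, there is a polynomial q of degree less than k such that
    1 - chi(t) = q(t) t. Since chi(H) = 0, the matrix q(H) inverts H, so
    y = alpha_1 beta_1 q(H) e_1 ([one_sub_prod_eq_mulX],
    [horner_mx_orthogonal_diag]).

    The bidiagonalization gives M^T M V = V H + (a multiple of v_(k+1)) e_k^T.
    Pairing with a right singular vector w of M, for the singular value s,
    makes the row r = w^T V a left eigenvector of H for s^2, up to a multiple
    of e_k^T ([gram_recurrence_row]). As H is tridiagonal, that last entry is
    invisible to polynomials of degree less than k evaluated on e_1, hence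
    r q(H) e_1 = q(s^2) r e_1 ([hessenberg_row_horner]). Finally
    alpha_1 beta_1 v_1 = M^T b, so that alpha_1 beta_1 r e_1 = s (p^T b) for
    the left singular vector p. Altogether
    s (w^T V y) = s^2 q(s^2) (p^T b) = (1 - chi(s^2)) (p^T b)
    ([singular_component_filter]), which is the filter of the singular value
    s. The expansion of x_k in the columns of G has the coefficients w^T V y,
    because G W^T is the inverse of the triangular factor.

    If beta_(k+1) = 0, then u_(k+1) is arbitrary, but its contributions to M V
    and to M^T M V carry the factor beta_(k+1), so the recurrences persist. *)

(** * Least squares *)

Lemma enormE (R : realType) (n : nat) (x : 'cV[R]_n) :
  enorm x = Num.sqrt ((x^T *m x) ord0 ord0).
Proof. by congr Num.sqrt; rewrite mxE; apply: eq_bigr => i _; rewrite mxE. Qed.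

Lemma gram_ge0 (R : realType) (n : nat) (x : 'cV[R]_n) :
  0 <= (x^T *m x) ord0 ord0.
Proof.
by rewrite mxE; apply: sumr_ge0 => i _; rewrite mxE -expr2 sqr_ge0.
Qed.

Lemma gram_eq0 (R : realType) (n : nat) (x : 'cV[R]_n) :
  (x^T *m x) ord0 ord0 = 0 -> x = 0.
Proof.
rewrite mxE => x0; apply/colP => i; rewrite [RHS]mxE; apply/eqP.
rewrite -sqrf_eq0 expr2; move/eqP: x0.
rewrite psumr_eq0 => [/allP/(_ i (mem_index_enum _))|j _]; rewrite !mxE //.
by rewrite -expr2 sqr_ge0.
Qed.

Lemma gramD (R : realType) (n : nat) (x z : 'cV[R]_n) (t : R) :
  ((x + t *: z)^T *m (x + t *: z)) ord0 ord0 =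
  (x^T *m x) ord0 ord0 + t * (x^T *m z) ord0 ord0 *+ 2
    + t ^+ 2 * (z^T *m z) ord0 ord0.
Proof.
have zx : (z^T *m x) ord0 ord0 = (x^T *m z) ord0 ord0.
  by rewrite -[in RHS](trmxK z) -trmx_mul [RHS]mxE.
rewrite [(_ + _)^T]linearD /= [(t *: z)^T]linearZ /= mulmxDl !mulmxDr.
rewrite -!scalemxAl -!scalemxAr scalerA ![(_ + _ : 'M_1) _ _]mxE.
rewrite ![(_ *: _ : 'M_1) _ _]mxE zx; ring.
Qed.

(** Moving from the minimizer in the direction of the gradient g = B^T r by t
    changes the squared residual by 2 t |g|^2 + t^2 |B g|^2, which is negative
    for a small t < 0 unless g = 0. *)
Lemma least_squares_normal_equation (R : realType) (m k : nat)
    (B : 'M[R]_(m, k)) (d : 'cV[R]_m) (y : 'cV[R]_k) :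
  is_argmin (fun z : 'cV[R]_k => enorm (B *m z - d)) y ->
  B^T *m B *m y = B^T *m d.
Proof.
move=> ymin; apply/eqP; rewrite -subr_eq0 -mulmxA -mulmxBr; apply/eqP.
set r := B *m y - d; set g := B^T *m r; apply: gram_eq0.
set a := (g^T *m g) ord0 ord0; set s := ((B *m g)^T *m (B *m g)) ord0 ord0.
have rBg : (r^T *m (B *m g)) ord0 ord0 = a.
  by rewrite /a {2}/g trmx_mul trmxK mulmxA.
have quad t : 0 <= t * a *+ 2 + t ^+ 2 * s.
  have := ymin (y + t *: g).
  have -> : B *m (y + t *: g) - d = r + t *: (B *m g).
    by rewrite mulmxDr -scalemxAr /r addrAC.
  rewrite !enormE ler_sqrt ?gram_ge0 // gramD rBg -/s.
  by rewrite -addrA lerDl.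
have s0 : 0 <= s := gram_ge0 _.
(* The optimal step is - a / s; s + 1 avoids a vanishing denominator. *)
have e_gt0 : 0 < (s + 1)^-1 by rewrite invr_gt0 ltr_wpDl.
have es : (s + 1)^-1 * s = 1 - (s + 1)^-1.
  by rewrite -[s in _ * s](addrK 1) mulrBr mulVf ?mulr1 // gt_eqF ?ltr_wpDl.
move: (s + 1)^-1 e_gt0 es (quad (- a * (s + 1)^-1)) => e e_gt0 es.
have -> : - a * e * a *+ 2 + (- a * e) ^+ 2 * s = - (a ^+ 2 * (e * (1 + e))).
  have -> : (- a * e) ^+ 2 * s = a ^+ 2 * e * (e * s) by ring.
  by rewrite es; ring.
rewrite oppr_ge0 pmulr_lle0 ?mulr_gt0 ?addr_gt0 // => a2_le0.
by apply/eqP; rewrite -sqrf_eq0 eq_le a2_le0 sqr_ge0.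
Qed.

(** * Polynomials of Hessenberg matrices *)

(** Each multiplication by an upper Hessenberg matrix moves the support of a
    vector down by at most one position. *)
Lemma hessenberg_expmx_col0 (F : comNzRingType) (k : nat) (H : 'M[F]_k.+1)
    (hH : forall i j : 'I_k.+1, (j.+1 < i)%N -> H i j = 0) (e : nat)
    (i : 'I_k.+1) :
  (e < i)%N -> (H ^+ e) i ord0 = 0.
Proof.
elim: e i => [|e IHe] i lt_ei.
  by rewrite expr0 mxE -val_eqE /= gtn_eqF.
rewrite exprS -mulmxE mxE big1 // => l _.
have [le_le|lt_el] := leqP l e; last by rewrite IHe // mulr0.
by rewrite hH ?mul0r // (leq_ltn_trans _ lt_ei).
Qed.

(** A row that is a left eigenvector up to its last entry behaves as a genuine
    left eigenvector on H^e e_1 as long as the defect is not reached, and the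
    last entry of H^e e_1 vanishes for e < k. This is the exactness of
    Krylov projections on polynomials of low degree. *)
Lemma hessenberg_row_horner (F : comNzRingType) (k : nat) (H : 'M[F]_k.+1)
    (hH : forall i j : 'I_k.+1, (j.+1 < i)%N -> H i j = 0)
    (r : 'rV[F]_k.+1) (d w : F)
    (hr : r *m H = d *: r + w *: delta_mx ord0 ord_max) (q : {poly F}) :
  (size q <= k.+1)%N ->
  (r *m horner_mx H q) ord0 ord0 = q.[d] * r ord0 ord0.
Proof.
move=> sq.
have rX e : (e <= k)%N -> (r *m H ^+ e) ord0 ord0 = d ^+ e * r ord0 ord0.
  elim: e => [|e IHe] le_ek; first by rewrite expr0 mulmx1 mul1r.
  rewrite exprS -mulmxE mulmxA hr mulmxDl -!scalemxAl -rowE.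
  rewrite ![(_ + _ : 'M__) _ _]mxE ![(_ *: _ : 'M__) _ _]mxE IHe;
    last exact: ltnW.
  rewrite [row _ _ _ _]mxE (hessenberg_expmx_col0 hH) // mulr0 addr0.
  by rewrite exprS mulrA.
rewrite -[in horner_mx H q](coefK q) poly_def raddf_sum mulmx_sumr.
rewrite summxE horner_coef mulr_suml; apply: eq_bigr => i _.
rewrite /= linearZ /= rmorphXn /= horner_mx_X -scalemxAr mxE rX ?mulrA //.
by rewrite -ltnS (leq_trans (ltn_ord i)).
Qed.

(** The product equals 1 at 0, whence the factor X. When the nodes s_j are
    nonzero, the product vanishes at them, so q interpolates 1 / t there. *)
Lemma one_sub_prod_eq_mulX (F : fieldType) (k : nat) (s : 'I_k -> F) :
  exists2 q : {poly F}, (size q <= k)%N &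
    1 - \prod_(j < k) (1 - (s j)^-1 *: 'X) = q * 'X.
Proof.
set chi := \prod_(j < k) _.
have chi0 : root (1 - chi) 0.
  rewrite rootE hornerD hornerN hornerC horner_prod big1 ?subrr // => j _.
  by rewrite hornerD hornerN hornerC hornerZ hornerX mulr0 subr0.
have [q qX] := factor_theorem _ _ chi0; rewrite subr0 in qX.
exists q => //; have [->|q0] := eqVneq q 0; first by rewrite size_poly0.
have size_chi : (size chi <= k.+1)%N.
  have := size_poly_prod_leq xpredT
    (fun j : 'I_k => 1 - (s j)^-1 *: 'X : {poly F}).
  rewrite -/chi card_ord => /leq_trans -> //.
  have : (\sum_(j < k) size (1 - (s j)^-1 *: 'X : {poly F})%R <= k * 2)%N.
    rewrite -[X in (_ <= X * 2)%N](card_ord k) -sum_nat_const.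
    apply: leq_sum => j _.
    rewrite (leq_trans (size_polyD _ _)) // geq_max size_poly1 size_polyN /=.
    by rewrite (leq_trans (size_scale_leq _ _)) // size_polyX.
  by rewrite leq_subLR muln2 -addnn addnS ltnS.
rewrite -ltnS -(size_mulX q0) -qX (leq_trans (size_polyD _ _)) // geq_max.
by rewrite size_poly1 size_polyN.
Qed.

Lemma horner_mx_orthogonal_diag (R : realType) (k : nat) (V H : 'M[R]_k.+1)
    (d : 'I_k.+1 -> R) (q : {poly R}) :
  orthonormal_cols V -> H = V *m diag_mx (\row_j d j) *m V^T ->
  (forall j, q.[d j] = 0) -> horner_mx H q = 0.
Proof.
move=> VV -> qd.
have [_ uV] := mulmx1_unit VV.
have -> : V^T = invmx V by rewrite -[LHS]mulmx1 -(mulmxV uV) mulmxA VV mul1mx.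
rewrite horner_mx_uconj // horner_mx_diag.
suff -> : map_mx (horner q) (\row_j d j) = 0 by rewrite linear0 mulmx0 mul0mx.
by apply/rowP => j; rewrite !mxE.
Qed.

(** * Singular values *)

Lemma gram_singular_values (R : realType) (m n : nat) (M : 'M[R]_(m, n))
    (s : 'I_n -> R) :
  singular_values M s -> exists2 V : 'M[R]_n, orthonormal_cols V &
    M^T *m M = V *m diag_mx (\row_j s j ^+ 2) *m V^T.
Proof.
case=> le_nm _ [U [V [UU VV MUV]]]; exists V => //.
set D := (X in U *m X) in MUV.
have DD : D^T *m D = diag_mx (\row_j s j ^+ 2).
  apply/matrixP => i j; rewrite !mxE (bigD1 (widen_ord le_nm i)) //= big1.
    rewrite !mxE /= eqxx mulr1n addr0 -val_eqE /=.
    by case: eqP => [/val_inj ->|];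
      rewrite ?mulr0 // expr2.
  move=> l; rewrite -val_eqE /= => /negPf li; rewrite !mxE.
  by rewrite li mul0r.
by rewrite MUV !trmx_mul trmxK !mulmxA -(mulmxA _ U^T) UU mulmx1 -DD !mulmxA.
Qed.

(** A zero singular value makes M vanish on the corresponding column of V. *)
Lemma singular_value_neq0 (R : realType) (m n : nat) (M : 'M[R]_(m, n))
    (s : 'I_n -> R) :
  singular_values M s -> (forall z : 'cV_n, M *m z = 0 -> z = 0) ->
  forall j, s j != 0.
Proof.
case=> _ _ [U [V [UU VV MUV]]] injM j; apply/eqP => sj0.
have /(congr1 (mulmx V^T)) : col j V = 0.
  apply: injM; rewrite MUV colE -!mulmxA (mulmxA V^T) VV mul1mx.
  rewrite -colE (_ : col j _ = 0) ?mulmx0 //.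
  by apply/colP => i; rewrite !mxE; case: eqP => // ij; rewrite sj0.
rewrite mulmx0 colE mulmxA VV mul1mx => /colP/(_ j)/eqP.
by rewrite !mxE !eqxx oner_eq0.
Qed.

(** * The bidiagonal recurrences *)

(** The summand is a function on all naturals so that the shifted indices of
    the bidiagonal matrix need no bound. *)
Lemma sum_mulrb_nat (V : nmodType) (k c : nat) (F : nat -> V) :
  \sum_(l < k) F l *+ (l == c :> nat) = F c *+ (c < k)%N.
Proof.
have [lt_ck|le_kc] := ltnP c k.
  rewrite (bigD1 (Ordinal lt_ck)) //= eqxx big1 ?addr0 // => l.
  by rewrite -val_eqE /= => /negPf ->.
by rewrite big1 // => l _; rewrite ltn_eqF // (leq_trans (ltn_ord l)).
Qed.

Lemma B_mxE (R : realType) (k : nat) (alpha beta : nat -> R) i j :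
  B_mx k alpha beta i j =
  alpha j.+1 *+ (i == j :> nat) + beta j.+2 *+ (i == j.+1 :> nat).
Proof.
rewrite mxE; have [->|_] := eqVneq (i : nat) j; first by rewrite ltn_eqF ?addr0.
by rewrite add0r; case: eqP.
Qed.

(** Forward substitution in the square lower triangular part. *)
Lemma B_mx_inj (R : realType) (k : nat) (alpha beta : nat -> R)
    (z : 'cV[R]_k) :
  (forall i, (1 <= i <= k)%N -> alpha i != 0) ->
  B_mx k alpha beta *m z = 0 -> z = 0.
Proof.
move=> alpha_neq0 Bz0; apply/colP => i; rewrite [RHS]mxE.
have [n le_in] := ubnP i; elim: n i le_in => // n IHn i le_in.
move/colP/(_ (widen_ord (leqnSn k) i)): Bz0; rewrite [RHS]mxE mxE.
rewrite (bigD1 i) //= big1 => [|j neq_ij]; rewrite B_mxE /=.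
  rewrite eqxx ltn_eqF // mulr1n !addr0 => /eqP.
  by rewrite mulf_eq0 (negPf (alpha_neq0 _ _)) ?ltn_ord //= => /eqP.
rewrite -val_eqE eq_sym in neq_ij; rewrite (negPf neq_ij) add0r.
case: eqP => [ij|]; last by rewrite mul0r.
by rewrite (IHn j) ?mulr0 // -ltnS -ij.
Qed.

Lemma B_mx_gram_hessenberg (R : realType) (k : nat) (alpha beta : nat -> R)
    (i j : 'I_k) :
  (j.+1 < i)%N -> ((B_mx k alpha beta)^T *m B_mx k alpha beta) i j = 0.
Proof.
move=> lt_ji; rewrite mxE big1 // => l _; rewrite mxE !B_mxE.
have [le_il|lt_li] := leqP i l.
  have lt_jl := leq_trans lt_ji le_il.
  by rewrite (gtn_eqF (ltnW lt_jl)) (gtn_eqF lt_jl) addr0 mulr0.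
by rewrite (ltn_eqF lt_li) (ltn_eqF (leqW lt_li)) addr0 mul0r.
Qed.

Lemma bidiagonalization_right (R : realType) (m n : nat) (M : 'M[R]_(m, n))
    (b : 'cV[R]_m) (k : nat) (alpha beta : nat -> R)
    (u : nat -> 'cV[R]_m) (v : nat -> 'cV[R]_n) :
  bidiagonalization M b k alpha beta u v ->
  M *m V_mx k v = V_mx k.+1 u *m B_mx k alpha beta.
Proof.
case=> _ _ _ rec _; apply/matrixP => a j.
have [/colP/(_ a) uE _] := rec j.+1 (ltn_ord j).
rewrite !mxE in uE *.
under [RHS]eq_bigr => l _ do rewrite B_mxE mxE mulrDr !mulrnAr.
rewrite big_split /= (sum_mulrb_nat _ _ (fun l => u l.+1 a ord0 * alpha j.+1)).
rewrite (sum_mulrb_nat _ _ (fun l => u l.+1 a ord0 * beta j.+2)).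
rewrite !ltnS ltn_ord ltnW // !mulr1n ![u _ _ _ * _]mulrC uE addrC subrK.
by apply: eq_bigr => l _; rewrite mxE.
Qed.

(** The last coefficient alpha_(k+1) lies outside the bidiagonal matrix, which
    leaves a rank-one defect in the last column. *)
Lemma bidiagonalization_left (R : realType) (m n : nat) (M : 'M[R]_(m, n))
    (b : 'cV[R]_m) (k : nat) (alpha beta : nat -> R)
    (u : nat -> 'cV[R]_m) (v : nat -> 'cV[R]_n) :
  bidiagonalization M b k alpha beta u v ->
  M^T *m V_mx k.+1 u = V_mx k v *m (B_mx k alpha beta)^T
    + (alpha k.+1 *: v k.+1) *m delta_mx ord0 ord_max.
Proof.
case=> _ _ init rec _; apply/matrixP => a i.
have -> : (M^T *m V_mx k.+1 u) a i = (M^T *m u i.+1) a ord0.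
  by rewrite !mxE; apply: eq_bigr => l _; rewrite !mxE.
rewrite [RHS]mxE [in RHS]mxE.
under [X in _ = X + _]eq_bigr => l _ do
  rewrite mxE [_^T _ _]mxE B_mxE mulrDr !mulrnAr eq_sym.
rewrite big_split /=.
rewrite (sum_mulrb_nat _ _ (fun l => v l.+1 a ord0 * alpha l.+1)).
have -> : ((alpha k.+1 *: v k.+1) *m delta_mx ord0 (@ord_max k)) a i =
    v k.+1 a ord0 * alpha k.+1 *+ (i == k :> nat).
  by rewrite mxE big_ord1 !mxE eqxx /= -val_eqE /= mulr_natr mulrC.
have -> : \sum_(l < k) v l.+1 a ord0 * beta l.+2 *+ (i == l.+1 :> nat) =
    (M^T *m u i.+1) a ord0 - alpha i.+1 * v i.+1 a ord0.
  (* The first column has no subdiagonal term: it is the initialization. *)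
  case: i => [[|i] lt_ik] /=.
    by rewrite -init big1 // [in RHS]mxE subrr.
  under eq_bigr => l _ do rewrite eqSS eq_sym.
  rewrite (sum_mulrb_nat _ _ (fun l => v l.+1 a ord0 * beta l.+2)) -ltnS lt_ik.
  have [_ /colP/(_ a)] := rec i.+1 lt_ik.
  by rewrite !mxE => ->; rewrite mulr1n opprB addrC subrK mulrC.
(* For i = k the term alpha_(i+1) v_(i+1) comes from the defect. *)
have := ltn_ord i; rewrite ltnS leq_eqVlt.
by case: eqP => [-> _|_ /= ->]; rewrite ?ltnn !mulr0n !mulr1n; ring.
Qed.

Lemma B_mx_tr_delta0 (R : realType) (k : nat) (alpha beta : nat -> R) :
  (B_mx k.+1 alpha beta)^T *m delta_mx ord0 ord0 =
  alpha 1%N *: delta_mx ord0 ord0 :> 'cV_k.+1.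
Proof.
rewrite -colE; apply/colP => i; rewrite [LHS]mxE [LHS]mxE B_mxE !mxE andbT.
by rewrite addr0 eq_sym -val_eqE /= mulr_natr; case: eqP => // ->.
Qed.

Lemma delta_max_B_mx (R : realType) (k : nat) (alpha beta : nat -> R) :
  delta_mx ord0 ord_max *m B_mx k.+1 alpha beta =
  beta k.+2 *: delta_mx ord0 ord_max :> 'rV_k.+1.
Proof.
rewrite -rowE; apply/rowP => j; rewrite [LHS]mxE B_mxE !mxE /=.
rewrite gtn_eqF // add0r eqSS eq_sym -val_eqE /= mulr_natr.
by case: eqP => // ->.
Qed.

(** Pairing M^T M V = V B^T B + (defect) with a singular vector of M. *)
Lemma gram_recurrence_row (R : realType) (m n : nat) (M : 'M[R]_(m, n))
    (b : 'cV[R]_m) (k : nat) (alpha beta : nat -> R)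
    (u : nat -> 'cV[R]_m) (v : nat -> 'cV[R]_n)
    (hbi : bidiagonalization M b k.+1 alpha beta u v)
    (s : R) (w : 'cV[R]_n) (p : 'cV[R]_m) :
  M *m w = s *: p -> M^T *m p = s *: w ->
  w^T *m V_mx k.+1 v *m ((B_mx k.+1 alpha beta)^T *m B_mx k.+1 alpha beta) =
  s ^+ 2 *: (w^T *m V_mx k.+1 v)
    + (- (alpha k.+2 * beta k.+2 * (w^T *m v k.+2) ord0 ord0))
      *: delta_mx ord0 ord_max.
Proof.
move=> Mw Mp.
have wM : w^T *m M^T = s *: p^T by rewrite -trmx_mul Mw linearZ.
have pM : p^T *m M = s *: w^T.
  by rewrite -(trmxK M) -trmx_mul Mp linearZ.
rewrite mulmxA -(mulmxA w^T) -[_ *m _^T](addrK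
  ((alpha k.+2 *: v k.+2) *m delta_mx ord0 ord_max)).
rewrite -(bidiagonalization_left hbi) mulmxBr mulmxBl; congr (_ + _).
  rewrite !mulmxA wM -!scalemxAl -[in LHS]mulmxA -(bidiagonalization_right hbi).
  by rewrite mulmxA pM -scalemxAl scalerA expr2.
rewrite scaleNr -!mulmxA delta_max_B_mx -!scalemxAl -!scalemxAr mulmxA.
rewrite {1}[w^T *m _]mx11_scalar mul_scalar_mx !scalerA; congr (- (_ *: _)).
Qed.

(** The filter of one singular value: w^T V y = r q(H) (alpha_1 beta_1 e_1),
    where the polynomial q(H) that inverts H acts on the row r = w^T V as the
    number q(s^2). This gives w^T V y = q(s^2) s (p^T b), and one more factor s
    completes s^2 q(s^2), the filter. *)
Lemma singular_component_filter (R : realType) (m n : nat) (M : 'M[R]_(m, n))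
    (b : 'cV[R]_m) (k : nat) (alpha beta : nat -> R)
    (u : nat -> 'cV[R]_m) (v : nat -> 'cV[R]_n)
    (hbi : bidiagonalization M b k.+1 alpha beta u v)
    (ct : 'I_k.+1 -> R) (hct : singular_values (B_mx k.+1 alpha beta) ct)
    (ct_neq0 : forall j, ct j != 0) (y : 'cV[R]_k.+1)
    (hy : (B_mx k.+1 alpha beta)^T *m B_mx k.+1 alpha beta *m y =
          (alpha 1%N * beta 1%N) *: delta_mx ord0 ord0)
    (s : R) (w : 'cV[R]_n) (p : 'cV[R]_m) :
  M *m w = s *: p -> M^T *m p = s *: w ->
  s * (w^T *m (V_mx k.+1 v *m y)) ord0 ord0 =
  (1 - \prod_j ((ct j ^+ 2 - s ^+ 2) / ct j ^+ 2)) * (p^T *m b) ord0 ord0.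
Proof.
move=> Mw Mp; have rH := gram_recurrence_row hbi Mw Mp.
set H := _^T *m _ in hy rH; set r := w^T *m V_mx k.+1 v in rH.
have [q sq qX] := one_sub_prod_eq_mulX (fun j => ct j ^+ 2).
have chiE t : (\prod_j (1 - (ct j ^+ 2)^-1 *: 'X)).[t] =
    \prod_j ((ct j ^+ 2 - t) / ct j ^+ 2).
  rewrite horner_prod; apply: eq_bigr => j _.
  rewrite hornerD hornerN hornerC hornerZ hornerX mulrBl mulfV ?sqrf_eq0 //.
  by rewrite [t * _]mulrC.
have [V VV HV] := gram_singular_values hct.
have chiH0 : horner_mx H (\prod_j (1 - (ct j ^+ 2)^-1 *: 'X)) = 0.
  apply: (horner_mx_orthogonal_diag VV HV) => j.
  by rewrite chiE (bigD1 j) //= subrr !mul0r.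
have qH : horner_mx H q *m H = 1%:M.
  have := congr1 (horner_mx H) qX.
  by rewrite rmorphB rmorph1 /= chiH0 subr0 rmorphM /= horner_mx_X; move/esym.
have yE : y = (alpha 1%N * beta 1%N) *: (horner_mx H q *m delta_mx ord0 ord0).
  by rewrite -[LHS]mul1mx -qH -mulmxA hy -scalemxAr.
have r0 : alpha 1%N * beta 1%N * r ord0 ord0 = s * (p^T *m b) ord0 ord0.
  case: hbi => _ betau alphav _ _.
  have v1E : r ord0 ord0 = (w^T *m v 1%N) ord0 ord0.
    by rewrite !mxE; apply: eq_bigr => l _; rewrite !mxE.
  have -> : s * (p^T *m b) ord0 ord0 = (w^T *m M^T *m b) ord0 ord0.
    by rewrite -trmx_mul Mw linearZ /= -scalemxAl [RHS]mxE.
  rewrite -betau -mulmxA -scalemxAr -alphav -!scalemxAr !scalerA [RHS]mxE v1E.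
  by rewrite [beta _ * _]mulrC.
rewrite mulmxA -/r yE -scalemxAr mulmxA -colE [(_ *: _ : 'M__) _ _]mxE.
rewrite [col _ _ _ _]mxE (hessenberg_row_horner _ rH sq) => [|i j]; last first.
  exact: B_mx_gram_hessenberg.
have /(congr1 (horner^~ (s ^+ 2))) /= := qX.
rewrite hornerD hornerN hornerC chiE hornerM hornerX => ->.
transitivity (s * q.[s ^+ 2] * (alpha 1%N * beta 1%N * r ord0 ord0)).
  by ring.
by rewrite r0; ring.
Qed.

(** * Expansion in the generalized singular vectors *)

Lemma orthonormal_diag_singular_pair (R : realType) (m n : nat)
    (hmn : (n <= m)%N) (M C : 'M[R]_(m, n)) (P : 'M[R]_m) (W : 'M[R]_n) :
  orthonormal_cols P -> orthonormal_cols W -> is_diag_mx C ->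
  M = P *m C *m W^T -> forall j : 'I_n,
    M *m col j W = C (widen_ord hmn j) j *: col (widen_ord hmn j) P /\
    M^T *m col (widen_ord hmn j) P = C (widen_ord hmn j) j *: col j W.
Proof.
move=> PP WW /is_diag_mxP Cdiag -> j.
have CE : C *m delta_mx j ord0 =
    C (widen_ord hmn j) j *: delta_mx (widen_ord hmn j) ord0 :> 'cV_m.
  rewrite -colE; apply/colP => i; rewrite !mxE andbT -val_eqE /= mulr_natr.
  have [eq_ij|/Cdiag ->//] := eqVneq (i : nat) j.
  by congr (C _ _); apply: val_inj.
have CTE : C^T *m delta_mx (widen_ord hmn j) ord0 =
    C (widen_ord hmn j) j *: delta_mx j ord0 :> 'cV_n.
  rewrite -colE; apply/colP => i; rewrite !mxE andbT -val_eqE /= mulr_natr.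
  have [eq_ij|neq_ij] := eqVneq (i : nat) j; last by rewrite Cdiag // eq_sym.
  by congr (C _ _); apply: val_inj.
rewrite !colE; split.
  by rewrite -!mulmxA (mulmxA W^T) WW mul1mx CE -scalemxAr.
by rewrite !trmx_mul trmxK -!mulmxA (mulmxA P^T) PP mul1mx CTE -scalemxAr.
Qed.

Lemma sum_first_last (V : nmodType) (n p : nat) (hpn : (p < n)%N)
    (F : 'I_n -> V) :
  \sum_j F j =
  \sum_(i < n - p) F (first_ord i) + \sum_(i < p) F (last_ord hpn i).
Proof.
rewrite (reindex (cast_ord (subnK (ltnW hpn)))) /=; last first.
  by apply: onW_bij; exists (cast_ord (esym (subnK (ltnW hpn)))) => j;
     rewrite ?cast_ordK ?cast_ordKV.
rewrite big_split_ord /=; congr (_ + _); apply: eq_bigr => i _.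
by congr F; apply: val_inj.
Qed.

Theorem theorem5p2 (R : realType) (m n p : nat)
    (hmn : (n <= m)%N) (hpn : (p < n)%N)
    (A : 'M[R]_(m, n)) (L : 'M[R]_(p, n)) (b : 'cV[R]_m)
    (hL : \rank L = minn n p)
    (hAL : forall x : 'cV[R]_n, A *m x = 0 -> L *m x = 0 -> x = 0)
    (hb : b != 0)
    (Q : 'M[R]_(m + p, n)) (T : 'M[R]_n)
    (hQR : compact_QR (col_mx A L) Q T)
    (PA : 'M[R]_m) (PL : 'M[R]_p) (W : 'M[R]_n)
    (C : 'M[R]_(m, n)) (S : 'M[R]_(p, n))
    (hCS : CS_decomposition (usubmx Q) (dsubmx Q) PA PL W C S)
    (c : nat -> R)
    (hC1 : forall i : 'I_(n - p),
       C (widen_ord hmn (first_ord i)) (first_ord i) = c 1%N)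
    (hC2 : forall i : 'I_p,
       C (widen_ord hmn (last_ord hpn i)) (last_ord hpn i) = c i.+2)
    (hc1 : c 1%N = 1)
    (hc_decr : forall i, (1 <= i <= p)%N -> c i.+1 < c i)
    (hc_pos : 0 < c p.+1)
    (k : nat) (hk : (1 <= k <= p.+1)%N)
    (alpha beta : nat -> R) (u : nat -> 'cV[R]_m) (v : nat -> 'cV[R]_n)
    (hbidiag : bidiagonalization (usubmx Q) b k alpha beta u v)
    (hnb : no_breakdown k alpha beta)
    (y : 'cV[R]_k)
    (hy : is_argmin
       (fun z : 'cV[R]_k =>
          enorm (B_mx k alpha beta *m z - beta 1%N *: delta_mx ord0 ord0)) y)
    (ct : 'I_k -> R) (hct : singular_values (B_mx k alpha beta) ct) :
  let Z : 'M[R]_(n, k) := invmx T *m V_mx k v in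
  let x : 'cV[R]_n := Z *m y in
  let G : 'M[R]_n := invmx T *m W in
  let G1 : 'M[R]_(n, n - p) := colsub (@first_ord n p) G in
  let P1A : 'M[R]_(m, n - p) :=
    colsub (fun i : 'I_(n - p) => widen_ord hmn (first_ord i)) PA in
  let g (i : 'I_p) : 'cV[R]_n := col (last_ord hpn i) G in
  let pA (i : 'I_p) : 'cV[R]_m := col (widen_ord hmn (last_ord hpn i)) PA in
  let gperp : 'cV[R]_n := G1 *m P1A^T *m b in
  let f (i : nat) : R :=
    1 - \prod_(j < k) ((ct j ^+ 2 - c i ^+ 2) / ct j ^+ 2) in
  L *m gperp = 0 /\
  x = f 1%N *: gperp +
      \sum_(i < p) (f i.+2 * (((pA i)^T *m b) ord0 ord0 / c i.+2)) *: g i.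
Proof.
move=> Z x G G1 P1A g pA gperp f.
case: hQR => QRE _ _ unitT; case: hCS => [[PP _ WW] [QAE QLE] Cdiag Szero _].
have WWt : W *m W^T = 1%:M by apply: mulmx1C.
split.
  (* L G_1 = P_L S W^T W_1, and the first n - p columns of S vanish. *)
  have -> : L = dsubmx Q *m T.
    by rewrite -(col_mxKd A L) QRE mul_dsub_mx.
  rewrite /gperp -(mulmxA G1) mulmxA.
  suff -> : dsubmx Q *m T *m G1 = 0 by rewrite mul0mx.
  apply/matrixP => a i; rewrite [RHS]mxE.
  have -> : (dsubmx Q *m T *m G1) a i =
      (dsubmx Q *m T *m G) a (first_ord i).
    by rewrite !mxE; apply: eq_bigr => l _; rewrite !mxE.
  rewrite /G -!mulmxA (mulmxA T) mulmxV // mul1mx QLE -mulmxA WW mulmx1.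
  rewrite mxE big1 // => l _; rewrite Szero ?mulr0 //=.
  by rewrite ltn_eqF // ltn_addr.
(* The case k = 0 is excluded; successors give square matrices their ring
   structure. *)
case: k hk hbidiag hnb y hy ct hct @Z @x @f => // k _ hbi nb y hy ct hct Z x f.
have alpha_neq0 i : (1 <= i <= k.+1)%N -> alpha i != 0 by case/nb.
have ct_neq0 := singular_value_neq0 hct (fun z => B_mx_inj alpha_neq0).
have normal := least_squares_normal_equation hy.
rewrite -scalemxAr B_mx_tr_delta0 scalerA mulrC in normal.
have c_gt0 d i : (i.+1 + d = p.+1)%N -> 0 < c i.+1.
  elim: d i => [|d IHd] i id; first by rewrite -(addn0 i.+1) id.
  apply: lt_trans (IHd i.+1 _) (hc_decr i.+1 _); first by rewrite -id addSnnS.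
  have : (i.+1 < p.+1)%N by rewrite -id -addSnnS leq_addr.
  by rewrite ltnS.
pose rho j := ((col j W)^T *m (V_mx k.+1 v *m y)) ord0 ord0.
pose pb j := ((col (widen_ord hmn j) PA)^T *m b) ord0 ord0.
have rhoE j s : C (widen_ord hmn j) j = s -> s * rho j =
    (1 - \prod_l ((ct l ^+ 2 - s ^+ 2) / ct l ^+ 2)) * pb j.
  move=> <-.
  have [Mw Mp] := orthonormal_diag_singular_pair hmn PP WW Cdiag QAE j.
  exact: (singular_component_filter hbi hct ct_neq0 normal Mw Mp).
have xE : x = \sum_j rho j *: col j G.
  have -> : x = G *m (W^T *m (V_mx k.+1 v *m y)).
    by rewrite /x /Z /G -!mulmxA (mulmxA W) WWt mul1mx.
  apply/colP => a; rewrite summxE mxE; apply: eq_bigr => j _.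
  rewrite mulrC [RHS]mxE [col _ _ _ _]mxE; congr (_ * _).
  by rewrite /rho !mxE; apply: eq_bigr => l _; rewrite !mxE.
have gperpE : gperp = \sum_(i < n - p) pb (first_ord i) *: col (first_ord i) G.
  rewrite /gperp -mulmxA; apply/colP => a; rewrite summxE mxE.
  apply: eq_bigr => j _; rewrite mulrC [RHS]mxE [col _ _ _ _]mxE.
  congr (_ * _); last by rewrite mxE.
  by rewrite /pb !mxE; apply: eq_bigr => l _; rewrite !mxE.
rewrite xE (sum_first_last hpn) gperpE scaler_sumr; congr (_ + _).
  apply: eq_bigr => i _; rewrite scalerA; congr (_ *: _).
  by rewrite -(rhoE _ _ (hC1 i)) hc1 mul1r.
apply: eq_bigr => i _; congr (_ *: _).
have ci_gt0 : 0 < c i.+2 by apply: (c_gt0 (p - i.+1)%N); rewrite addSn subnKC.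
by rewrite mulrA -(rhoE _ _ (hC2 i)) mulrAC divff ?mul1r // gt_eqF.
Qed.
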